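(* Let $G$ be a finite unoriented simple graph with vertex set $\{1,\dots,n\}$, $n\ge 1$. Let $A$ be the adjacency matrix of $G$, let $D$ be the diagonal matrix whose $i$-th diagonal entry is the valency (degree) of the vertex $i$, and let $L=A-D$. Then the number of spanning trees of $G$ is equal to $|C(L)|$, where $C(L)$ denotes the common value of all the cofactors of $L$.
   Context: For an $n\times n$ matrix $L$, $M_{ij}(L)$ denotes the submatrix obtained by deleting the $i$-th row and the $j$-th column, and the $i,j$ cofactor of $L$ is $C_{ij}(L)=(-1)^{i+j}\det M_{ij}(L)$ (the determinant of the empty matrix is $1$). A matrix $L$ is called Laplace-like if it is symmetric and each of its rows sums to zero; the matrix $L=A-D$ is Laplace-like. If $L$ is Laplace-like then all its cofactors $C_{ij}(L)$ are equal, and $C(L)$ denotes their common value. A spanning tree of $G$ is a subgraph of $G$ that is a tree and contains all the vertices of $G$. *)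

(* Defs.v *)
From mathcomp Require Import all_boot all_order all_algebra.

Set Implicit Arguments.
Unset Strict Implicit.
Unset Printing Implicit Defensive.

Import GRing.Theory Num.Theory.

Record sgraph (T : finType) := SGraph {
  adj :> rel T;
  adj_sym : symmetric adj;
  adj_irr : irreflexive adj }.

Section Subgraphs.
Variable T : finType.
Implicit Types (G : sgraph T) (H : {set T} * {set {set T}}).

(* An edge is the unordered pair of its endpoints. *)
Definition edges G : {set {set T}} :=
  [set [set p.1; p.2] | p : T * T & G p.1 p.2].

(* A candidate subgraph H is a pair (vertex set, edge set). *)
Definition subgraph G H : bool :=
  (H.2 \subset edges G) && [forall f in H.2, f \subset H.1].

Definition sub_adj H : rel T := [rel x y | [set x; y] \in H.2].

Definition connected H : bool :=
  (H.1 != set0) && [forall x in H.1, forall y in H.1, connect (sub_adj H) x y].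

(* A cycle has at least three vertices, all distinct.  Bounding its length by
   #|T| makes the predicate boolean and loses nothing: see acyclicP. *)
Definition acyclic H : bool :=
  [forall k : 'I_#|T|.+1, forall c : k.-tuple T,
     (2 < k) ==> ~~ ucycleb (sub_adj H) c].

Lemma acyclicP H :
  reflect (forall c : seq T, 2 < size c -> ~ ucycle (sub_adj H) c) (acyclic H).
Proof.
apply: (iffP idP) => [acH c c_gt2 cycc | acH].
  have c_lt : size c < #|T|.+1.
    by case/andP: cycc => _ /card_uniqP <-; rewrite ltnS max_card.
  have /forallP/(_ (in_tuple c)) := forallP acH (Ordinal c_lt).
  by rewrite /= c_gt2 /= => /negP; apply.
apply/forallP => k; apply/forallP => c; apply/implyP => k_gt2.
by apply/negP; apply: acH; rewrite size_tuple.
Qed.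

Definition tree H : bool := connected H && acyclic H.

Definition spanning_tree G H : bool :=
  [&& subgraph G H, tree H & H.1 == setT].

Definition num_spanning_trees G : nat := #|[set H | spanning_tree G H]|.

Definition degree G (x : T) : nat := #|[set y | G x y]|.

End Subgraphs.

Local Open Scope ring_scope.

Definition adjacency_mx n (G : sgraph 'I_n) : 'M[int]_n :=
  \matrix_(i, j) (G i j)%:R.

Definition degree_mx n (G : sgraph 'I_n) : 'M[int]_n :=
  diag_mx (\row_i (degree G i)%:R).

Definition laplacian n (G : sgraph 'I_n) : 'M[int]_n :=
  adjacency_mx G - degree_mx G.

(* For n >= 1 there is at most one such c. *)
Definition common_cofactor n (L : 'M[int]_n) (c : int) : Prop :=
  forall i j : 'I_n, cofactor L i j = c.

(* Main.v *)
(* Up to sign, expand the determinant of L, with row r replaced by the unit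
   vector e_r, as a sum over functions f choosing one term
   G i (f i) * (e_i - e_(f i)) in each row i <> r.  The determinant with these
   rows is 1 if every vertex reaches r by iterating f and 0 otherwise, and the
   functions of the first kind are the parent functions of the spanning trees
   of G rooted at r. *)
Require Import Defs.
From mathcomp Require Import all_boot all_order fingroup perm all_algebra.

Set Implicit Arguments.
Unset Strict Implicit.
Unset Printing Implicit Defensive.

Import GRing.Theory Num.Theory.

Lemma eq_set2 (T : finType) (a b x y : T) :
  ([set a; b] == [set x; y]) =
  ((a == x) && (b == y)) || ((a == y) && (b == x)).
Proof.
apply/eqP/orP => [eqS | [] /andP[/eqP-> /eqP->] //]; last exact: setUC.
have := set21 a b; have := set22 a b; rewrite eqS !inE.
have := set21 x y; have := set22 x y; rewrite -eqS !inE.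
rewrite !(eq_sym x) !(eq_sym y).
by case: (a == x); case: (a == y); case: (b == x); case: (b == y); auto.
Qed.

(** * Trees encoded by parent functions *)

Section RootedFunctions.
Variables (T : finType) (r : T).
Implicit Types (f g : T -> T).

(** A tree with root [r], given by its parent map; the root is its own parent, so that the map is
    total. *)
Definition rooted f := (f r == r) && [forall x, fconnect f x r].

(** The root is left out because its loop would add the singleton of [r]. *)
Definition parent_edges f : {set {set T}} :=
  [set [set x; f x] | x in [set~ r]].

Lemma parent_edgeE f x y :
  ([set x; y] \in parent_edges f) =
  ((x != r) && (f x == y)) || ((y != r) && (f y == x)).
Proof.
apply/imsetP/orP => [[z]|[] /andP[nr /eqP<-]].
- rewrite !inE => zr /eqP; rewrite eq_set2.
  by case/orP=> /andP[/eqP-> /eqP->]; rewrite eqxx zr; [left | right].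
- by exists x; rewrite ?inE.
- by exists y; rewrite ?inE // setUC.
Qed.

(** Makes [findex f x r] usable as the depth of [x] in the tree. *)
Lemma rooted_depth f x :
  rooted f -> x != r -> findex f x r = (findex f (f x) r).+1.
Proof.
by case/andP=> _ /forallP fr xr; rewrite fconnect_findex // eq_sym.
Qed.

(** If [f x] is the root, so is [f (f x)]; otherwise two steps of [f] lower the depth by two. *)
Lemma rooted_no2cycle f x : rooted f -> x != r -> f (f x) != x.
Proof.
move=> Rf xr; apply/eqP => ffx.
have fxr : f x != r.
  apply: contraNneq xr => fx; rewrite -ffx fx.
  by case/andP: Rf.
have := rooted_depth Rf xr; rewrite (rooted_depth Rf fxr) ffx => /eqP.
by rewrite -addn2 -[X in X == _]addn0 eqn_add2l.
Qed.

Lemma rooted_acyclic f : rooted f -> acyclic (setT, parent_edges f).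
Proof.
move=> Rf; apply/acyclicP => c c_gt2 /andP[cycc uc].
have [x0 x0c] : exists x, x \in c.
  by case: c c_gt2 {cycc uc} => // x c; exists x; rewrite mem_head.
(* Both neighbours of a deepest vertex of a cycle would be its parent. *)
case: (@arg_maxnP _ x0 (mem c) (fun x => findex f x r) x0c) => x xc deepest.
have parent y : y \in c -> [set x; y] \in parent_edges f -> y = f x.
  move=> yc; rewrite parent_edgeE => /orP[] /andP[nr /eqP] // fy.
  by have := deepest y yc; rewrite (rooted_depth Rf nr) fy /= ltnn.
have nxt : next c x = f x.
  by apply: parent; rewrite ?mem_next //; apply: (next_cycle cycc xc).
have prv : prev c x = f x.
  apply: parent; rewrite ?mem_prev // setUC; exact: (prev_cycle cycc xc).
(* Hence [next] applied twice fixes [x], whereas on a cycle starting [x, y, z] it leads to [z]. *)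
have := next_prev uc x; rewrite prv -nxt => nn.
have [i p cE] := rot_to xc.
have:= nn; rewrite -!(next_rot i uc) cE.
have: uniq (x :: p) by rewrite -cE rot_uniq.
have: 2 < size (x :: p) by rewrite -cE size_rot.
case: p {cE} => [|y [|z p]] //= _ /and3P[+ + _].
rewrite !inE !negb_or eqxx => /and3P[xy xz _] _.
by rewrite eq_sym (negPf xy) eqxx => zx; rewrite zx eqxx in xz.
Qed.

Lemma parent_edges_inj f g :
  rooted f -> rooted g -> parent_edges f = parent_edges g -> f =1 g.
Proof.
move=> Rf Rg eqE x; apply: contraTeq isT => bad_x.
have [/eqP frr /forallP conf] := andP Rf; have [/eqP grr _] := andP Rg.
(* Where the parents of y differ, g goes back from f y to y, so they differ
   at f y as well; this propagates up to the root, where they agree. *)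
have step y : f y != g y -> f (f y) != g (f y).
  move=> bad_y; have yr : y != r by apply: contraNneq bad_y => ->; rewrite frr grr.
  have : [set y; f y] \in parent_edges g by rewrite -eqE parent_edgeE yr eqxx.
  rewrite parent_edgeE yr eq_sym (negPf bad_y) /= => /andP[_ /eqP->].
  exact: rooted_no2cycle.
have : f r != g r.
  rewrite -(iter_findex (conf x)); elim: (findex f x r) => //= k; exact: step.
by rewrite frr grr eqxx.
Qed.

(** As in breadth-first search, the parent is a vertex one [e]-step away and strictly closer to
    [r]. *)
Lemma connect_parent (e : rel T) :
  (forall x, connect e x r) ->
  exists2 f : T -> T, rooted f & forall x, x != r -> e x (f x).
Proof.
move=> conn.
pose P x n := [exists p : n.-tuple T, path e x p && (last x p == r)].
have exP x : exists n, P x n.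
  have [p ep rp] := connectP (conn x); exists (size p).
  by apply/existsP; exists (in_tuple p); rewrite /= ep -rp /=.
pose d x := ex_minn (exP x).
have closer x : x != r -> exists y, e x y && (d y < d x).
  move=> xr; rewrite {2}/d; case: ex_minnP => -[|n] /existsP[p].
    by rewrite tuple0 /= (negPf xr).
  case/tupleP: p => y p /= /andP[/andP[exy py] lp] _; exists y; rewrite exy ltnS.
  by rewrite /d; case: ex_minnP => m _; apply; apply/existsP; exists p; rewrite py.
(* The default [x] is never taken: [closer] provides a candidate whenever [x != r]. *)
pose f x := if x == r then r else odflt x [pick y | e x y && (d y < d x)].
have fP x : x != r -> e x (f x) && (d (f x) < d x).
  move=> xr; rewrite /f (negPf xr); case: pickP => //= no.
  by have [y] := closer x xr; rewrite no.
exists f => [|x /fP/andP[] //]; rewrite /rooted {1}/f eqxx eqxx /=.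
apply/forallP => x; have [n] := ubnP (d x); elim: n x => // n IH x.
rewrite ltnS => dx; have [->|xr] := eqVneq x r; first exact: connect0.
have /andP[_ lt] := fP x xr; apply: connect_trans (fconnect1 f x) _.
exact: IH (leq_trans lt dx).
Qed.

End RootedFunctions.

(** * Spanning trees correspond to parent functions *)

Section SpanningTrees.
Variables (T : finType) (G : sgraph T) (r : T).

Lemma sub_adjE (H : {set T} * {set {set T}}) x y :
  sub_adj H x y = ([set x; y] \in H.2).
Proof. by []. Qed.

Lemma sub_adj_sym (H : {set T} * {set {set T}}) : symmetric (sub_adj H).
Proof. by move=> x y; rewrite !sub_adjE setUC. Qed.

Lemma edgesE x y : ([set x; y] \in edges G) = G x y.
Proof.
apply/imsetP/idP => [[[a b] /[!inE]/= Gab /eqP]|Gxy]; last by exists (x, y); rewrite ?inE.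
rewrite eq_set2; case/orP=> /andP[/eqP-> /eqP->] //.
by rewrite (adj_sym G).
Qed.

Definition parent_function : {set {ffun T -> T}} :=
  [set f : {ffun T -> T} | rooted r f && [forall x, (x != r) ==> G x (f x)]].

Lemma parent_spanning_tree (f : {ffun T -> T}) :
  f \in parent_function -> spanning_tree G (setT, parent_edges r f).
Proof.
rewrite inE => /andP[Rf /forall_inP Gf].
apply/and3P; split=> //; apply/andP; split.
- by apply/subsetP => _ /imsetP[x xr ->]; rewrite edgesE Gf // -in_setC1.
- by apply/forall_inP => F _; apply: subsetT.
- apply/andP; split; first by apply/set0Pn; exists r.
  have tor x : connect (sub_adj (setT, parent_edges r f)) x r.
    have [/eqP frr /forallP/(_ x)] := andP Rf.
    apply: connect_sub => y _ /eqP <-.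
    have [->|yr] := eqVneq y r; first by rewrite /= frr connect0.
    by apply: connect1; rewrite sub_adjE parent_edgeE yr eqxx.
  apply/forall_inP => x _; apply/forall_inP => y _.
  apply: connect_trans (tor x) _.
  by rewrite (sym_connect_sym (@sub_adj_sym _)).
- exact: rooted_acyclic.
Qed.

(** Connectedness gives a parent function with all its edges in [H]; acyclicity then leaves no room
    for a further edge. *)
Lemma spanning_tree_parent H :
  spanning_tree G H ->
  exists2 f : {ffun T -> T}, f \in parent_function & H = (setT, parent_edges r f).
Proof.
case: H => V E /and3P[/andP[/= subE _] /andP[conn /acyclicP acyc] /eqP /= VT].
subst V; case/andP: conn => _ /forall_inP conn.
have [g Rg Hg] : exists2 g, rooted r g &
    forall x, x != r -> sub_adj (setT, E) x (g x).
  by apply: connect_parent => x; have /forall_inP := conn x (in_setT x); apply.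
pose f := finfun g; have fE : f =1 g by apply: ffunE.
have Rf : rooted r f.
  rewrite /rooted fE; case/andP: Rg => -> /forallP cg.
  by apply/forallP => x; rewrite (eq_fconnect fE).
have Gf : f \in parent_function.
  rewrite inE Rf; apply/forall_inP => x xr.
  rewrite fE -edgesE; exact: (subsetP subE) (Hg x xr).
exists f => //; congr pair; apply/eqP; rewrite eqEsubset andbC.
have subH : parent_edges r f \subset E.
  by apply/subsetP => _ /imsetP[x xr ->]; rewrite fE -(sub_adjE (setT, E)) Hg -?in_setC1.
rewrite subH; apply/subsetP => F FE.
have /imsetP[[x y] /[!inE]/= Gxy eF] := subsetP subE F FE; subst F.
(* Otherwise the edge xy closes the path from x to y in the tree of f. *)
apply: contraT => notf.
have /and3P[_ /andP[/andP[_ /forall_inP cf] _] _] := parent_spanning_tree Gf.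
have /forall_inP/(_ y (in_setT y)) := cf x (in_setT x).
case/connectP => p0 /shortenP[p pp up _] ly {p0}.
have xy : x != y by apply: contraTneq Gxy => ->; rewrite (adj_irr G).
case: (acyc (x :: p)).
(* A cycle needs three vertices: an empty path would give [x = y], and a single step would make [xy]
   a parent edge. *)
- case: p pp up ly => [|z [|? ?]] //=; first by move=> _ _ yx; rewrite yx eqxx in xy.
  by rewrite andbT sub_adjE /= => zE _ yz; rewrite yz zE in notf.
- have subr : subrel (sub_adj (setT, parent_edges r f)) (sub_adj (setT, E)).
    by move=> a b; apply: (subsetP subH).
  apply/andP; split=> //; rewrite (cycle_path x); apply/andP; split.
    by rewrite sub_adjE -[last _ _]ly setUC.
  exact: sub_path pp.
Qed.

Lemma num_spanning_trees_parent : num_spanning_trees G = #|parent_function|.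
Proof.
rewrite -(@card_in_imset _ _ (fun f : {ffun T -> T} => ([set: T], parent_edges r f))).
  apply: eq_card => H; rewrite inE; apply/idP/imsetP => [/spanning_tree_parent|].
    by case=> f Pf ->; exists f.
  by case=> f Pf ->; apply: parent_spanning_tree.
move=> f g /[!inE] /andP[Rf _] /andP[Rg _] [eqE].
by apply/ffunP; apply: parent_edges_inj eqE.
Qed.

End SpanningTrees.

Local Open Scope ring_scope.

(** * Determinants and cofactors *)

Definition replace_row (R : Type) n (L : 'M[R]_n) (i : 'I_n) (v : 'I_n -> R) : 'M[R]_n :=
  \matrix_(k, j) if k == i then v j else L k j.

Lemma det_replace_row (R : comNzRingType) n (L : 'M[R]_n) (i : 'I_n) v :
  \det (replace_row L i v) = \sum_j v j * cofactor L i j.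
Proof.
rewrite (expand_det_row _ i); apply: eq_bigr => j _; rewrite mxE eqxx.
congr (_ * (_ * \det _)); apply/matrixP => a b; rewrite !mxE.
by rewrite eq_sym (negPf (neq_lift _ _)).
Qed.

Lemma cofactor_replace_row (R : comNzRingType) n (L : 'M[R]_n) i j :
  cofactor L i j = \det (replace_row L i (fun k => (k == j)%:R)).
Proof.
rewrite det_replace_row (bigD1 j) //= eqxx mul1r big1 ?addr0 // => k /negPf->.
by rewrite mul0r.
Qed.

Lemma det_eq0_col (R : idomainType) n (L : 'M[R]_n) (v : 'I_n -> R) i :
  v i != 0 -> (forall k, \sum_j L k j * v j = 0) -> \det L = 0.
Proof.
move=> vi Lv; apply/eqP; rewrite -det_tr; apply/det0P; exists (\row_j v j).
  by apply: contraNneq vi => /rowP/(_ i); rewrite !mxE => ->.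
apply/rowP => k; rewrite !mxE -[RHS](Lv k); apply: eq_bigr => j _.
by rewrite !mxE mulrC.
Qed.

(** The difference is a determinant whose row [i] is [e_j - e_j']; all its rows sum to zero, so the
    all-ones vector lies in the kernel. *)
Lemma cofactor_row_const (R : idomainType) n (L : 'M[R]_n) i j j' :
  (forall k, \sum_l L k l = 0) -> cofactor L i j = cofactor L i j'.
Proof.
move=> L0; apply/eqP; rewrite -subr_eq0.
have <- : \det (replace_row L i (fun k => (k == j)%:R - (k == j')%:R)) =
          cofactor L i j - cofactor L i j'.
  rewrite !cofactor_replace_row !det_replace_row -sumrB.
  by apply: eq_bigr => k _; rewrite mulrBl.
apply/eqP/(@det_eq0_col _ _ _ (fun=> 1) i); first exact: oner_neq0.
move=> k; under eq_bigr do rewrite mulr1 mxE.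
case: (k == i); last exact: L0.
by rewrite sumrB -!natr_sum -!big_mkcond !big_pred1_eq subrr.
Qed.

Lemma cofactor_const (R : idomainType) n (L : 'M[R]_n) i j i' j' :
  L^T = L -> (forall k, \sum_l L k l = 0) -> cofactor L i j = cofactor L i' j'.
Proof.
move=> symL L0; rewrite (cofactor_row_const _ _ i' L0) -cofactor_tr symL.
exact: cofactor_row_const.
Qed.

(** Multilinearity in the rows, applied to all rows at once. *)
Lemma det_row_sums (R : comNzRingType) n (J : finType)
    (w : 'I_n -> J -> R) (B : 'I_n -> J -> 'I_n -> R) :
  \det (\matrix_(i, j) \sum_k w i k * B i k j) =
  \sum_(f : {ffun 'I_n -> J})
     (\prod_i w i (f i)) * \det (\matrix_(i, j) B i (f i) j).
Proof.
rewrite /determinant; under [RHS]eq_bigr do rewrite mulr_sumr.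
rewrite exchange_big; apply: eq_bigr => s _ /=.
under eq_bigr do rewrite mxE.
rewrite bigA_distr_bigA mulr_sumr; apply: eq_bigr => f _.
rewrite big_split /= mulrCA; congr (_ * (_ * _)).
by apply: eq_bigr => i _; rewrite mxE.
Qed.

Definition parent_mx (R : pzRingType) n (r : 'I_n) (f : 'I_n -> 'I_n) : 'M[R]_n :=
  \matrix_(i, j) ((j == i)%:R - (if i == r then 0 else (j == f i)%:R)).

Lemma det_parent_mx (R : idomainType) n (r : 'I_n) f :
  f r = r -> \det (parent_mx R r f) = (rooted r f)%:R.
Proof.
move=> frr; have [Rf | notR] := boolP (rooted r f).
  have fix_r i : f i = i -> i = r.
    by move=> fi; apply: contraTeq isT => /(rooted_no2cycle Rf); rewrite !fi eqxx.
  rewrite /determinant (bigD1 (1%g : 'S_n)) //= odd_perm1 mul1r [X in X + _]big1 => [|i _].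
    rewrite big1 ?addr0 // => s s1; apply/eqP; rewrite mulf_eq0 signr_eq0 /=.
    (* In a nonzero term a moved index i has s i = f i, and f i is then moved
       too by injectivity; following f, so would be the root. *)
    apply: contraNT s1 => nz_s; apply/eqP/permP => i; rewrite perm1.
    have moved k : s k != k -> (k != r) && (s k == f k).
      move=> sk; have /prodf_neq0/(_ k isT) := nz_s.
      rewrite mxE (negPf sk) sub0r oppr_eq0.
      by case: (k == r); rewrite ?eqxx //; case: (s k == f k); rewrite ?eqxx.
    apply: contraTeq isT => /= si.
    have : s r != r.
      have [_ /forallP/(_ i)/iter_findex <-] := andP Rf.
      elim: (findex f i r) => //= m IH; have /andP[_ /eqP <-] := moved _ IH.
      by rewrite (inj_eq perm_inj).
    by move/moved; rewrite eqxx.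
  (* The identity permutation contributes 1: [f] fixes only [r], so every diagonal entry is 1. *)
  rewrite mxE perm1 eqxx; case: eqVneq => [_ | ir]; first exact: subr0.
  by case: eqP => [/esym/fix_r ifr | _]; [rewrite ifr eqxx in ir | rewrite subr0].
move: notR; rewrite /rooted frr eqxx /= negb_forall => /existsP[i ni].
(* The indicator of the indices that do not reach r lies in the kernel. *)
apply: (@det_eq0_col _ _ _ (fun j => (~~ fconnect f j r)%:R) i) => [|k].
  by rewrite ni oner_eq0.
under eq_bigr do rewrite mxE mulrBl.
rewrite sumrB (bigD1 k) //= eqxx mul1r big1 ?addr0 => [|j /negPf->]; last exact: mul0r.
have [->|kr] := eqVneq k r.
  by rewrite connect0 big1 ?subr0 // => j _; rewrite mul0r.
rewrite (bigD1 (f k)) //= eqxx mul1r big1 ?addr0 => [|j /negPf->]; last exact: mul0r.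
by rewrite (fconnect_eqVf f k) (negPf kr) subrr.
Qed.

(** * Cofactors of the Laplacian *)

Section MatrixTree.
Variables (n : nat) (G : sgraph 'I_n).

Lemma laplacian_sym : (laplacian G)^T = laplacian G.
Proof.
apply/matrixP => i j; rewrite !mxE (adj_sym G) eq_sym.
by case: eqP => [->|_]; rewrite ?mulr0n.
Qed.

Lemma laplacian_row_sum i : \sum_j laplacian G i j = 0.
Proof.
under eq_bigr do rewrite !mxE.
rewrite sumrB -natr_sum -big_mkcond sum1_card /degree cardsE.
rewrite [X in _ - X](bigD1 i) //= eqxx.
rewrite [X in _ - (_ + X)]big1 => [|j /negPf]; last by rewrite eq_sym => ->.
by rewrite addr0 subrr.
Qed.

Lemma cofactor_laplacian (r : 'I_n) :
  cofactor (laplacian G) r r = (-1) ^+ n.-1 * (num_spanning_trees G)%:R.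
Proof.
(* Row [i != r] of [A - D] is the sum over [k] of [- G i k * (e_i - e_k)]. In row [r] only [k = r]
   has nonzero weight, so only functions fixing [r] survive. *)
pose w i k : int := if i == r then (k == r)%:R else - (G i k)%:R.
pose B i k j : int := (j == i)%:R - (if i == r then 0 else (j == k)%:R).
rewrite cofactor_replace_row.
have -> : replace_row (laplacian G) r (fun k => (k == r)%:R) =
          \matrix_(i, j) \sum_k w i k * B i k j.
  apply/matrixP => i j; rewrite !mxE /w /B; case: eqVneq => [->|ir].
    rewrite (bigD1 r) //= eqxx mul1r subr0 big1 ?addr0 // => k /negPf->.
    exact: mul0r.
  under eq_bigr do rewrite mulNr mulrBr.
  rewrite sumrN sumrB -mulr_suml opprB; congr (_ - _).
    rewrite (bigD1 j) //= eqxx mulr1 big1 ?addr0 // => k.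
    by rewrite eq_sym => /negPf->; rewrite mulr0.
  rewrite -natr_sum -big_mkcond sum1_card /degree cardsE eq_sym.
  by case: eqP => _; rewrite ?mulr1 ?mulr0.
rewrite det_row_sums (num_spanning_trees_parent G r).
rewrite -sum1_card natr_sum mulr_sumr [RHS]big_mkcond; apply: eq_bigr => f _.
rewrite -/(parent_mx _ r f) inE (bigD1 r) //= {1}/w eqxx.
have [frr|nfr] := eqVneq (f r) r; last first.
  by rewrite /rooted (negPf nfr) /= !mul0r.
rewrite det_parent_mx // mul1r; case: (rooted r f); rewrite ?mulr0 //= !mulr1.
(* If all parents are neighbours, each of the [n.-1] rows other than [r] gives a factor -1; a single
   non-neighbour makes the product vanish. *)
case: ifP => [/forall_inP Gf | /negbT].
  under eq_bigr => i ir do rewrite /w (negPf ir) (Gf i ir).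
  rewrite prodr_const; congr (_ ^+ _).
  by rewrite cardC1 card_ord.
rewrite negb_forall => /existsP[i]; rewrite negb_imply => /andP[ir /negPf nG].
by rewrite (bigD1 i) //= /w (negPf ir) nG oppr0 mul0r.
Qed.

End MatrixTree.

Theorem corollary2 (n : nat) (n_gt0 : (0 < n)%N) (G : sgraph 'I_n) :
  exists c : int,
    common_cofactor (laplacian G) c /\
    num_spanning_trees G = `|c|%N.
Proof.
pose r := Ordinal n_gt0; exists (cofactor (laplacian G) r r); split=> [i j|].
  exact: cofactor_const (laplacian_sym G) (laplacian_row_sum G).
by rewrite cofactor_laplacian abszMsign natz.
Qed.
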